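(* Let $\zeta$ be a primitive aperiodic substitution on the two-letter alphabet $\{0,1\}$, with Perron--Frobenius eigenvalue $\theta_1$ and second eigenvalue $\theta_2$ of its substitution matrix. For $n\ge 1$ let $a(n)$ and $b(n)$ be, respectively, the minimum and the maximum number of $0$'s in allowed words of $\zeta$ of length $n$. Suppose that $|\theta_2|>1$. Then there exists a constant $c_1>0$ such that for all $n\ge1$ $$b(n)-a(n)\ \ge\ c_1 n^{\alpha},\qquad\text{where } \alpha=\frac{\log|\theta_2|}{\log\theta_1}\in(0,1).$$
   Context: A substitution on $\{0,1\}$ is a map $\zeta$ from $\{0,1\}$ to the set of nonempty finite words over $\{0,1\}$, extended to words by concatenation. $\ell_i(W)$ is the number of occurrences of the letter $i$ in a word $W$. The substitution matrix is $M=(m_{i,j})$ with $m_{i,j}=\ell_i(\zeta(j))$; $\theta_1$ is its Perron--Frobenius eigenvalue and $\theta_2$ the other eigenvalue. $\zeta$ is primitive if some power $M^k$ has all entries strictly positive. $X_\zeta\subset\{0,1\}^{\mathbb Z}$ is the set of all two-sided sequences every finite subword of which occurs in $\zeta^k(i)$ for $k$ sufficiently large. $\zeta$ is aperiodic if $X_\zeta$ is infinite. The allowed words are the finite words occurring in elements of $X_\zeta$. *)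

(* Defs.v *)
From HB Require Import structures.
From mathcomp Require Import all_boot all_order all_algebra.
From mathcomp Require Import all_classical all_reals all_analysis.
Set Implicit Arguments.
Unset Strict Implicit.
Unset Printing Implicit Defensive.
Import Order.TTheory GRing.Theory Num.Theory.
Local Open Scope ring_scope.

Definition word : Type := seq 'I_2.

Definition is_substitution (zeta : 'I_2 -> word) : Prop :=
  forall i, zeta i != [::].

Definition subst_word (zeta : 'I_2 -> word) (w : word) : word :=
  flatten (map zeta w).

Definition subst_iter (zeta : 'I_2 -> word) (k : nat) (i : 'I_2) : word :=
  iter k (subst_word zeta) [:: i].

Definition subst_mx (R : nzRingType) (zeta : 'I_2 -> word) : 'M[R]_2 :=
  \matrix_(i, j) (count_mem i (zeta j))%:R.

Definition is_primitive (zeta : 'I_2 -> word) : Prop :=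
  exists k : nat, forall i j : 'I_2, 0 < (subst_mx int zeta ^+ k) i j.

(* The Perron-Frobenius eigenvalue is the eigenvalue equal to the spectral
   radius. Real mu suffice here: a real 2 x 2 matrix with one real eigenvalue
   has no nonreal eigenvalue. *)
Definition PF_eigenvalue (R : realType) (A : 'M[R]_2) (theta : R) : Prop :=
  eigenvalue A theta /\ forall mu : R, eigenvalue A mu -> `|mu| <= theta.

Definition subword (x : int -> 'I_2) (p : int) (n : nat) : word :=
  mkseq (fun i : nat => x (p + i%:Z)) n.

Definition subst_shift (zeta : 'I_2 -> word) : set (int -> 'I_2) :=
  [set x | forall (p : int) (n : nat), exists K : nat,
     forall (k : nat) (i : 'I_2), (K <= k)%N ->
       infix (subword x p n) (subst_iter zeta k i)].

Definition is_aperiodic (zeta : 'I_2 -> word) : Prop :=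
  infinite_set (subst_shift zeta).

Definition allowed (zeta : 'I_2 -> word) (w : word) : Prop :=
  exists2 x, subst_shift zeta x & exists p : int, w = subword x p (size w).

Definition zeros (w : word) : nat := count_mem (ord0 : 'I_2) w.

(* The default value n of the minimum is harmless: a word of length n has at
   most n zeros. *)
Definition min_zeros (zeta : 'I_2 -> word) (n : nat) : nat :=
  \big[minn/n]_(w : n.-tuple 'I_2 | `[< allowed zeta w >]) zeros w.

Definition max_zeros (zeta : 'I_2 -> word) (n : nat) : nat :=
  \max_(w : n.-tuple 'I_2 | `[< allowed zeta w >]) zeros w.

(* Main.v *)
(* Let u be a left eigenvector of the substitution matrix for theta2; its two
   entries have opposite signs, so over words of a fixed length n the weight
   u.l(w) is an increasing affine function of the number of zeros, and it
   satisfies u.l(zeta^k(w)) = theta2^k u.l(w).  Choose k with theta1^k of order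
   n and a large constant j.  The word zeta^(k+j)(i) has weight of absolute
   value at least (C+1)|theta2|^k, and it splits into a prefix shorter than n
   and boundedly many blocks of length n.  Since |theta2| > 1, decomposing the
   prefix along the levels of the substitution bounds its weight by
   C|theta2|^k, so some block has weight at least a constant times |theta2|^k,
   which is of order n^alpha.  As the entries of u have opposite signs, this
   produces a block of large positive weight for one letter i, and one of large
   negative weight for the other. *)
Require Import Defs.
From HB Require Import structures.
From mathcomp Require Import all_boot all_order all_algebra.
From mathcomp Require Import all_classical all_reals all_analysis.
From mathcomp Require Import zify ring lra.
Set Implicit Arguments.
Unset Strict Implicit.
Unset Printing Implicit Defensive.
Import Order.TTheory GRing.Theory Num.Theory.
Local Open Scope ring_scope.

(** * Iterates of a substitution on words *)

Lemma subst_word_cat zeta s t :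
  subst_word zeta (s ++ t) = subst_word zeta s ++ subst_word zeta t.
Proof. by rewrite /subst_word map_cat flatten_cat. Qed.

Lemma iter_subst_cat zeta k s t :
  iter k (subst_word zeta) (s ++ t) =
  iter k (subst_word zeta) s ++ iter k (subst_word zeta) t.
Proof. by elim: k => //= k ->; rewrite subst_word_cat. Qed.

Lemma iter_subst_flatten zeta k w :
  iter k (subst_word zeta) w = flatten (map (subst_iter zeta k) w).
Proof.
elim: w => [|i w IHw] /=; first by elim: k => //= k ->.
by rewrite -cat1s iter_subst_cat IHw.
Qed.

Lemma subst_iterD zeta m k i :
  subst_iter zeta (m + k) i = iter m (subst_word zeta) (subst_iter zeta k i).
Proof. exact: iterD. Qed.

Lemma subst_iterS zeta k i :
  subst_iter zeta k.+1 i = flatten (map (subst_iter zeta k) (zeta i)).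
Proof. by rewrite -addn1 subst_iterD iter_subst_flatten /= /subst_word /= cats0. Qed.

Lemma iter_subst_neq0 zeta k w :
  is_substitution zeta -> w != [::] -> iter k (subst_word zeta) w != [::].
Proof.
move=> zs wn; elim: k => //= k; case: (iter k _ w) => // i t _.
by rewrite /subst_word /=; case: (zeta i) (zs i).
Qed.

Lemma subst_iter_neq0 zeta k i :
  is_substitution zeta -> subst_iter zeta k i != [::].
Proof. by move=> zs; apply: iter_subst_neq0. Qed.

Lemma infix_iter_subst zeta k s t :
  infix s t -> infix (iter k (subst_word zeta) s) (iter k (subst_word zeta) t).
Proof.
by move=> /infixP[p [q ->]]; rewrite !iter_subst_cat infix_infix.
Qed.

Lemma mem_infix1 (i : 'I_2) (w : word) : i \in w -> infix [:: i] w.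
Proof.
by case/splitPr => p q; apply/infixP; exists p, q.
Qed.

(** The cut falls inside a single block [g i], and all blocks before it are complete. With [g] an
    iterate of the substitution, this peels one level off a prefix. *)
Lemma take_flatten_map (g : 'I_2 -> word) (w : word) n :
  exists m i n', take n (flatten (map g w)) =
    flatten (map g (take m w)) ++ take n' (g i).
Proof.
elim: w n => [|i w IHw] n /=; first by exists 0, ord0, 0; rewrite take0.
rewrite take_cat; case: ltnP => _; first by exists 0, i, n.
have [m [j [n' ->]]] := IHw (n - size (g i))%N.
by exists m.+1, j, n'; rewrite /= catA.
Qed.

(** * Primitivity and allowed words *)

Lemma subst_mx_exp (zeta : 'I_2 -> word) k i j :
  (subst_mx int zeta ^+ k) i j = (count_mem i (subst_iter zeta k j))%:R.
Proof.
elim: k i j => [|k IHk] i j.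
  by rewrite expr0 mxE /= addn0 eq_sym.
rewrite exprS mxE /=.
under eq_bigr => l _ do rewrite IHk mxE.
elim: (subst_iter zeta k j) => [|a w IHw] /=.
  by rewrite big1 // => l _; rewrite mulr0.
rewrite /subst_word /= count_cat natrD -[in RHS]IHw -/(subst_word _ _).
under eq_bigr => l _ do rewrite natrD mulrDr.
rewrite big_split /=; congr (_ + _).
rewrite (bigD1 a) //= eqxx mulr1 big1 ?addr0 // => l /negbTE.
by rewrite eq_sym => ->; rewrite mulr0.
Qed.

(** Positivity at one exponent N persists: zeta^k(j) is zeta^N applied to the nonempty word
    zeta^(k-N)(j), and the image of any of its letters contains both letters. *)
Lemma primitive_mem (zeta : 'I_2 -> word) :
  is_substitution zeta -> is_primitive zeta ->
  exists N, forall k i j, (N <= k)%N -> i \in subst_iter zeta k j.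
Proof.
move=> zs [N NP]; exists N.
have mN i j : i \in subst_iter zeta N j.
  by have := NP i j; rewrite subst_mx_exp ltr0n -has_count has_pred1.
move=> k i j leNk; rewrite -(subnKC leNk) subst_iterD.
case: (subst_iter zeta (k - N) j) (subst_iter_neq0 (k - N) j zs) => // l w _.
by rewrite -cat1s iter_subst_cat mem_cat mN.
Qed.

(** For large k the letter i occurs in zeta^(k-m)(j), hence zeta^m(i) occurs in zeta^k(j). One
    occurrence thus gives the uniform condition in [subst_shift]. *)
Lemma infix_subst_iter_large (zeta : 'I_2 -> word) w m i :
  is_substitution zeta -> is_primitive zeta ->
  infix w (subst_iter zeta m i) ->
  exists K, forall k j, (K <= k)%N -> infix w (subst_iter zeta k j).
Proof.
move=> zs zp wi; have [N NP] := primitive_mem zs zp.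
exists (m + N)%N => k j leK.
have lemk : (m <= k)%N by apply: leq_trans leK; rewrite leq_addr.
rewrite -(subnKC lemk) subst_iterD; apply: infix_trans wi _.
by apply/infix_iter_subst/mem_infix1/NP; rewrite leq_subRL.
Qed.

Lemma infix_cat_neq0 (P w Q : word) : P != [::] -> Q != [::] ->
  exists a b, infix (a :: rcons w b) (P ++ w ++ Q).
Proof.
case/lastP: P => // P a _; case: Q => // b Q _; exists a, b.
by apply/infixP; exists P, Q; rewrite /= !cat_rcons.
Qed.

(** The word zeta^(2N)(i) has an interior letter y, and zeta^N(y) contains i. So zeta^(m+3N)(i)
    contains a copy of zeta^m(i) with nonempty words on both sides. *)
Lemma subst_iter_extend (zeta : 'I_2 -> word) w m i :
  is_substitution zeta -> is_primitive zeta ->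
  infix w (subst_iter zeta m i) ->
  exists a b k j, infix (a :: rcons w b) (subst_iter zeta k j).
Proof.
move=> zs zp wi; have [N NP] := primitive_mem zs zp.
have size2 j : (1 < size (subst_iter zeta N j))%N.
  have := NP N ord0 j (leqnn _); have := NP N ord_max j (leqnn _).
  case: (subst_iter zeta N j) => [|a [|b s]] //.
  by rewrite !inE => /eqP <- /eqP.
have : (2 < size (subst_iter zeta (N + N) i))%N.
  rewrite subst_iterD iter_subst_flatten.
  case: (subst_iter zeta N i) (size2 i) => [|a [|b s]] //= _.
  rewrite !size_cat; have := size2 a; have := size2 b; lia.
rewrite -/(subst_iter _ _ _).
case E: (subst_iter zeta (N + N) i) => [|x [|y [|z s]]] // _.
have [p [q Epq]] := infixP (mem_infix1 (NP N i y (leqnn _))).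
have [p' [q' Ew]] := infixP wi.
suff [a [b abW]] : exists a b, infix (a :: rcons w b)
    (subst_iter zeta (m + (N + (N + N))) i).
  by exists a, b, (m + (N + (N + N)))%N, i.
rewrite subst_iterD (subst_iterD _ N) E.
rewrite -[x :: _]/([:: x] ++ [:: y] ++ (z :: s)) !iter_subst_cat.
rewrite -/(subst_iter zeta N x) -/(subst_iter zeta N y) Epq !iter_subst_cat.
rewrite -/(subst_iter zeta m i) Ew -!catA catA catA (catA q').
apply: infix_cat_neq0; rewrite -?size_eq0 !size_cat !addn_eq0 !size_eq0.
  by rewrite !negb_and iter_subst_neq0 // subst_iter_neq0.
by rewrite negb_and (iter_subst_neq0 m) ?orbT // iter_subst_neq0.
Qed.

(** Extending w by one letter on each side again and again, inside iterates of the substitution,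
    yields in the limit a two-sided sequence of the subshift that contains w. *)
Lemma infix_allowed (zeta : 'I_2 -> word) w m i :
  is_substitution zeta -> is_primitive zeta ->
  infix w (subst_iter zeta m i) -> allowed zeta w.
Proof.
move=> zs zp wi.
pose L (s : word) := exists k j, infix s (subst_iter zeta k j).
have [g gP] : {g : word -> 'I_2 * 'I_2 &
    forall s, L s -> L ((g s).1 :: rcons s (g s).2)}.
  apply: (@choice _ _ (fun s p => L s -> L (p.1 :: rcons s p.2))) => s.
  have [Ls|nLs] := pselect (L s); last by exists (ord0, ord0).
  have [k [j sj]] := Ls.
  by have [a [b [k' [j' abs]]]] := subst_iter_extend zs zp sj;
    exists (a, b); exists k', j'.
pose W t := iter t (fun s => (g s).1 :: rcons s (g s).2) w.
have LW t : L (W t) by elim: t => [|t /gP //]; exists m, i.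
have sizeW t : size (W t) = (size w + t + t)%N.
  by elim: t => [|t IHt] /=; rewrite ?addn0 // size_rcons IHt addnS addnS.
(* Each extension shifts the indices by one, so w starts at index t of [W t], and position p of the
   limit is index p + t. *)
have nthW t d k : (k < size w + t + t)%N ->
    nth ord0 (W (t + d)%N) (k + d) = nth ord0 (W t) k.
  move=> kt; elim: d => [|d IHd]; first by rewrite !addn0.
  rewrite !addnS /= nth_rcons sizeW; case: ltnP => //; lia.
(* After |p| + 1 extensions the index of position p is in range, and later extensions do not change
   the letter there. *)
pose x (p : int) := nth ord0 (W `|p|.+1) (absz (p + `|p|.+1%:Z)).
have xE p t : (`|p| < t)%N -> x p = nth ord0 (W t) (absz (p + t%:Z)).
  move=> pt; rewrite /x -(subnKC pt).
  have -> : absz (p + (`|p|.+1 + (t - `|p|.+1))%N%:Z) =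
            (absz (p + `|p|.+1%:Z)%R + (t - `|p|.+1))%N by lia.
  rewrite nthW //; lia.
have subE p n t : (`|p| + n < t)%N ->
    subword x p n = take n (drop (absz (p + t%:Z)) (W t)).
  move=> pnt; apply: (@eq_from_nth _ ord0) => [|k].
    rewrite size_mkseq size_takel // size_drop sizeW; lia.
  rewrite size_mkseq => kn; rewrite nth_mkseq // nth_take // nth_drop.
  rewrite (xE _ t); last by lia.
  by congr nth; lia.
exists x.
  move=> p n; rewrite (subE p n (`|p| + n).+1) //.
  have [k [j Wkj]] := LW (`|p| + n).+1.
  apply: (infix_subst_iter_large (m := k) (i := j) zs zp).
  apply: infix_trans Wkj.
  exact: infix_trans (infix_take _ _) (infix_drop _ _).
exists 0; apply: (@eq_from_nth _ ord0) => [|k kw]; first by rewrite size_mkseq.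
rewrite nth_mkseq // add0r (xE _ k.+1) //.
by have := @nthW 0%N k.+1 k; rewrite /= !addn0 => /(_ kw) <-.
Qed.

(** * Weights of words and of prefixes *)

Definition weight (V : nmodType) (u : 'I_2 -> V) (w : word) : V :=
  \sum_(i <- w) u i.

(** The equation u M = theta u for the substitution matrix M, read column by column: the weight of
    [zeta i] is entry i of u M. *)
Definition left_eigenvector (R : pzRingType) (zeta : 'I_2 -> word)
    (theta : R) (u : 'I_2 -> R) :=
  forall i, weight u (zeta i) = theta * u i.

Lemma weight_cat (V : nmodType) (u : 'I_2 -> V) s t :
  weight u (s ++ t) = weight u s + weight u t.
Proof. exact: big_cat. Qed.

Lemma weight1 (V : nmodType) (u : 'I_2 -> V) i : weight u [:: i] = u i.
Proof. exact: big_seq1. Qed.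

Lemma weightN (V : zmodType) (u : 'I_2 -> V) w :
  weight (fun i => - u i) w = - weight u w.
Proof. by rewrite /weight sumrN. Qed.

Lemma weight_count (V : nmodType) (u : 'I_2 -> V) w :
  weight u w = u ord0 *+ count_mem ord0 w + u ord_max *+ count_mem ord_max w.
Proof.
rewrite /weight; elim: w => [|i w IHw]; first by rewrite big_nil !mulr0n addr0.
rewrite big_cons IHw /= !mulrnDr.
case: i => [[|[|//]] hi]; rewrite /= ?(mulr0n, mulr1n, add0r) addrA //.
  by congr (u _ + _ + _); apply: val_inj.
by rewrite [RHS]addrCA addrA; congr (u _ + _ + _); apply: val_inj.
Qed.

Lemma weight_iter_subst (R : comPzRingType) (zeta : 'I_2 -> word) (theta : R) u k w :
  left_eigenvector zeta theta u ->
  weight u (iter k (subst_word zeta) w) = theta ^+ k * weight u w.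
Proof.
move=> ev; elim: k => [|k /= IHk]; first by rewrite mul1r.
rewrite exprS -mulrA -IHk; elim: (iter k _ w) => [|i s IHs].
  by rewrite /weight !big_nil mulr0.
by rewrite -cat1s subst_word_cat !weight_cat mulrDr IHs
  /subst_word weight1 /= ev /weight big_nil addr0.
Qed.

Lemma weight_ge_size (R : numDomainType) (v : 'I_2 -> R) m w :
  (forall i, m <= v i) -> m * (size w)%:R <= weight v w.
Proof.
move=> mv; rewrite /weight -sum1_size natr_sum mulr_sumr.
by apply: ler_sum => i _; rewrite mulr1.
Qed.

Lemma weight_le_size (R : numDomainType) (v : 'I_2 -> R) m w :
  (forall i, v i <= m) -> weight v w <= m * (size w)%:R.
Proof.
move=> mv; rewrite /weight -sum1_size natr_sum mulr_sumr.
by apply: ler_sum => i _; rewrite mulr1.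
Qed.

(** Blocks of length n are cut off from the right end, so that the remainder is a prefix; weights of
    prefixes can be bounded separately. *)
Lemma weight_le_blocks (R : numDomainType) (u : 'I_2 -> R) n (e : R) w :
  (forall x, infix x w -> size x = n -> weight u x <= e) ->
  weight u w <= weight u (take (size w %% n) w) + e *+ (size w %/ n).
Proof.
have := divn_eq (size w) n; move: (_ %/ _)%N (_ %% _)%N => q r.
elim: q w => [|q IHq] w Ew we.
  by rewrite mulr0n addr0 take_oversize // Ew.
pose w' := take (q * n + r) w.
have sw' : size w' = (q * n + r)%N by rewrite size_takel // Ew; lia.
have {}IHq := IHq w' sw' _.
rewrite -[in leLHS](cat_take_drop (q * n + r) w) -/w' weight_cat mulrSr addrA.
apply: lerD; last by apply: we; rewrite ?infix_drop // size_drop Ew; lia.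
have -> : take r w = take r w' by rewrite take_takel // leq_addl.
by apply: IHq => x xw'; apply: we; apply: infix_trans xw' (infix_take _ _).
Qed.

Lemma weight_take_bounded (R : numDomainType) (zeta : 'I_2 -> word) (u : 'I_2 -> R) :
  exists2 B, 0 < B & forall i n, `|weight u (take n (zeta i))| <= B.
Proof.
pose c := `|u ord0| + `|u ord_max|.
have uc i : `|u i| <= c.
  rewrite /c; case: i => [[|[|//]] hi].
    by rewrite (_ : Ordinal hi = ord0) ?lerDl //; apply: val_inj.
  by rewrite (_ : Ordinal hi = ord_max) ?lerDr //; apply: val_inj.
have c0 : 0 <= c by rewrite addr_ge0.
(* The sum over both letters makes the bound independent of i, and the summand 1 makes it
   positive. *)
exists (1 + \sum_i c * (size (zeta i))%:R).
  by rewrite ltr_pwDl // sumr_ge0 // => i _; rewrite mulr_ge0.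
move=> i n; apply: le_trans (ler_norm_sum _ _ _) _.
rewrite (bigD1 i) //= ler_wpDl // -[leLHS]addr0 lerD ?sumr_ge0 //; last first.
  by move=> j _; rewrite mulr_ge0.
apply: (@le_trans _ _ (c * (size (take n (zeta i)))%:R)); last first.
  by rewrite ler_wpM2l // ler_nat size_take_min geq_minr.
exact: (weight_le_size (v := fun i => `|u i|)).
Qed.

(** A prefix of zeta^(K+1)(i) is zeta^K of a prefix of zeta(i), followed by a prefix of some
    zeta^K(j). The contributions of the levels form a geometric sum, dominated by its top term
    because |theta| > 1. *)
Lemma weight_take_subst_iter (R : numFieldType) (zeta : 'I_2 -> word)
    (theta : R) u :
  1 < `|theta| -> left_eigenvector zeta theta u ->
  exists2 C, 0 < C & forall K i n,
    `|weight u (take n (subst_iter zeta K i))| <= C * `|theta| ^+ K.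
Proof.
move=> th1 ev; have [B B0 BP] := weight_take_bounded zeta u.
have [B' B'0 BP'] := weight_take_bounded (fun i => [:: i]) u.
have d0 : 0 < `|theta| - 1 by rewrite subr_gt0.
(* This C satisfies B + C <= C |theta|, which closes the induction; [B'] takes care of K = 0. *)
exists (B' + B / (`|theta| - 1)); first by rewrite addr_gt0 ?divr_gt0.
have tge0 K : 0 <= `|theta| ^+ K by rewrite exprn_ge0.
elim=> [|K IHK] i n.
  by apply: le_trans (BP' i n) _; rewrite expr0 mulr1 lerDl divr_ge0 // ltW.
rewrite subst_iterS.
have [m [j [n' ->]]] := take_flatten_map (subst_iter zeta K) (zeta i) n.
rewrite -iter_subst_flatten weight_cat (weight_iter_subst _ _ ev).
apply: le_trans (ler_normD _ _) _; rewrite normrM normrX.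
apply: le_trans (lerD (ler_wpM2l (tge0 K) (BP i m)) (IHK j n')) _.
rewrite exprS mulrA.
rewrite [leLHS](_ : _ = (B' + B * (1 + (`|theta| - 1)^-1)) * `|theta| ^+ K); last by ring.
apply: ler_wpM2r => //.
have -> : (B' + B / (`|theta| - 1)) * `|theta| =
  B' + B' * (`|theta| - 1) + B * (1 + (`|theta| - 1)^-1).
  by field; rewrite gt_eqF.
by rewrite lerD2r lerDl mulr_ge0 // ltW.
Qed.

(* As long as K > k, the first block zeta^(K-1)(j) of zeta^K(i) alone weighs more
   than the prefix, so that the prefix is a prefix of this block. *)
Lemma take_subst_iter_short (R : numDomainType) (zeta : 'I_2 -> word)
    (theta m : R) v k K i n :
  is_substitution zeta -> left_eigenvector zeta theta v ->
  0 < m -> (forall i, m <= v i) -> 1 <= theta ->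
  weight v (take n (subst_iter zeta K i)) < m * theta ^+ k ->
  exists K' j n', (K' <= k)%N /\
    take n (subst_iter zeta K i) = take n' (subst_iter zeta K' j).
Proof.
move=> zs ev m0 mv th1.
have wt0 w : 0 <= weight v w.
  by apply: le_trans (weight_ge_size w mv); rewrite mulr_ge0 // ltW.
elim: K i n => [|K IHK] i n hw; first by exists 0, i, n.
have [leKk|ltkK] := leqP K.+1 k; first by exists K.+1, i, n.
move: hw; rewrite subst_iterS; case: (zeta i) (zs i) => //= j w _.
rewrite take_cat; case: ltnP => [_|_]; first exact: IHK.
rewrite weight_cat (weight_iter_subst K [:: j] ev) weight1 => /lt_geF.
case/negP; rewrite -[leLHS]addr0 lerD // mulrC.
by apply: ler_pM; rewrite ?ler_weXn2l // ltW // (lt_le_trans ltr01, exprn_gt0) //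
  (lt_le_trans ltr01).
Qed.

(** * A block of large weight *)

Lemma exprn_unbounded (R : archiRealFieldType) (x y : R) :
  1 < x -> exists j, y <= x ^+ j.
Proof.
move=> x1; have x0 : 0 < x - 1 by rewrite subr_gt0.
have bern j : 1 + (x - 1) *+ j <= x ^+ j.
  elim: j => [|j IHj]; first by rewrite expr0 mulr0n addr0.
  rewrite exprS mulrS; apply: le_trans (ler_wpM2l _ IHj); last by lra.
  have : 0 <= (x - 1) * ((x - 1) *+ j) by rewrite mulr_ge0 ?mulrn_wge0 // ltW.
  by move: (_ *+ j) => z; nra.
exists (Num.bound `|y / (x - 1)|); apply: le_trans (bern _).
apply: (@le_trans _ _ ((x - 1) * (Num.bound `|y / (x - 1)|)%:R)); last first.
  by rewrite mulr_natr lerDr.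
rewrite mulrC -ler_pdivrMr // ltW //.
exact: le_lt_trans (ler_norm _) (archi_boundP (normr_ge0 _)).
Qed.

(** The number e stands for any upper bound on the weights of blocks of length n. In this form the
    result applies to u and to -u, and so to the maximum and the minimum number of zeros. *)
Lemma weight_block_ge (R : realType) (zeta : 'I_2 -> word)
    (theta1 theta2 alpha m M : R) (v u : 'I_2 -> R) (i1 i2 : 'I_2) :
  is_substitution zeta ->
  1 < theta1 -> left_eigenvector zeta theta1 v ->
  0 < m -> (forall i, m <= v i) -> (forall i, v i <= M) ->
  1 < `|theta2| -> left_eigenvector zeta theta2 u ->
  0 < u i1 -> u i2 < 0 ->
  0 <= alpha -> theta1 `^ alpha = `|theta2| ->
  exists2 c, 0 < c & forall n e, (0 < n)%N ->
    (forall w K i, infix w (subst_iter zeta K i) -> size w = n ->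
       weight u w <= e) ->
    c * n%:R `^ alpha <= e.
Proof.
move=> zs th1 ev1 m0 mv vM th2 ev2 u1 u2 al0 alE.
have [C C0 CP] := weight_take_subst_iter th2 ev2.
have leMm : m <= M := le_trans (mv ord0) (vM ord0).
have M0 : 0 < M := lt_le_trans m0 leMm.
have th1_0 : 0 < theta1 := lt_trans ltr01 th1.
have th2_0 : 0 < `|theta2| := lt_trans ltr01 th2.
pose mu := Num.min (u i1) (- u i2).
have mu0 : 0 < mu by rewrite lt_min u1 oppr_gt0.
(* The exponent j does not depend on n. It makes the weight of the whole word exceed the bound on
   its prefix by |theta2|^k. *)
have [j] := exprn_unbounded ((C + 1) / mu) th2.
rewrite ler_pdivrMr // => jP.
(* This will bound the number of blocks: m |W| is at most the v-weight of W, which is at most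
   theta1^(k+j) M, and theta1^k <= theta1 M n / m. *)
pose Q := theta1 ^+ j.+1 * (M / m) ^+ 2.
have Q0 : 0 < Q by rewrite mulr_gt0 ?exprn_gt0 ?divr_gt0.
exists Q^-1 => [|n e n0 eP]; first by rewrite invr_gt0.
have nR0 : 0 < n%:R :> R by rewrite ltr0n.
(* The least such k is used: the strict inequality makes words of length at most n lighter than m
   theta1^k, and minimality bounds theta1^k above by a multiple of n. *)
have exk : exists k, M * n%:R < m * theta1 ^+ k.
  have [k kP] := exprn_unbounded (M * n%:R / m + 1) th1; exists k.
  by rewrite [ltRHS]mulrC -ltr_pdivrMr //; apply: lt_le_trans kP; rewrite ltrDl.
case: (ex_minnP exk) => k kP kmin.
have leth1k : theta1 ^+ k <= theta1 * (M * n%:R / m).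
  case: k {kP} kmin (kP) => [|k] kmin kP.
    by move: kP; rewrite expr0 mulr1 => /lt_geF/negP [];
      rewrite -[leLHS]mulr1 ler_pM ?ler1n // ltW.
  rewrite exprS ler_pM2l // ler_pdivlMr // [leLHS]mulrC leNgt; apply/negP => /kmin.
  by rewrite ltnn.
(* As theta2 may be negative, the letter is chosen by the sign of theta2^(k+j), so that the weight
   of zeta^(k+j)(i) is positive. *)
have [i iP] : exists i, (C + 1) * `|theta2| ^+ k <= theta2 ^+ (k + j) * u i.
  have muP x : mu <= x -> (C + 1) * `|theta2| ^+ k <= `|theta2| ^+ (k + j) * x.
    move=> mux; rewrite exprD -mulrA mulrC ler_pM2l ?exprn_gt0 //.
    by apply: le_trans jP _; rewrite ler_pM2l ?exprn_gt0.
  have [thge0|thlt0] := leP 0 (theta2 ^+ (k + j)).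
    by exists i1; rewrite -(ger0_norm thge0) normrX muP // ge_min lexx.
  exists i2; rewrite -[leRHS]mulrNN -(ltr0_norm thlt0) normrX muP // ge_min lexx.
  by rewrite orbT.
pose W := subst_iter zeta (k + j) i.
have sW : (size W %/ n)%:R <= Q.
  rewrite -(ler_pM2r nR0) -natrM; apply: (@le_trans _ _ (size W)%:R).
    by rewrite ler_nat leq_trunc_div.
  rewrite -(ler_pM2l m0); apply: le_trans (weight_ge_size W mv) _.
  rewrite (weight_iter_subst _ _ ev1) weight1 exprD.
  apply: (@le_trans _ _ (theta1 * (M * n%:R / m) * theta1 ^+ j * M)).
    apply: ler_pM => //; rewrite ?mulr_ge0 ?exprn_ge0 //; try exact: ltW.
      exact: le_trans (ltW m0) (mv i).
    by rewrite ler_pM2r ?exprn_gt0.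
  by rewrite /Q exprS le_eqVlt; apply/orP; left; apply/eqP; field; rewrite gt_eqF.
(* The prefix is shorter than n, so its v-weight is below m theta1^k. It is therefore a prefix of an
   iterate of level at most k, and not only k + j. *)
have rP : weight u (take (size W %% n) W) <= C * `|theta2| ^+ k.
  have [K' [i' [n' [leK' ->]]]] : exists K' i' n', (K' <= k)%N /\
      take (size W %% n) W = take n' (subst_iter zeta K' i').
    apply: (take_subst_iter_short zs ev1 m0 mv (ltW th1)).
    apply: le_lt_trans kP; apply: le_trans (weight_le_size _ vM) _.
    rewrite ler_pM2l // ler_nat size_take_min.
    by rewrite (leq_trans (geq_minl _ _)) // ltnW // ltn_pmod.
  apply: le_trans (ler_norm _) _; apply: le_trans (CP _ _ _) _.
  by rewrite ler_pM2l // ler_weXn2l // ltW.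
have := weight_le_blocks (fun x xW => eP x _ _ xW) : weight u W <= _.
rewrite (weight_iter_subst _ _ ev2) weight1 => Wle.
have ek : `|theta2| ^+ k <= e * (size W %/ n)%:R.
  rewrite mulr_natr; move: (le_trans iP Wle) rP.
  by rewrite mulrDl mul1r; lra.
(* The sign of e is needed to replace the number of blocks by its upper bound Q. *)
have e0 : 0 < e.
  rewrite ltNge; apply/negP => e0.
  have := lt_le_trans (exprn_gt0 k th2_0) ek.
  by rewrite ltNge mulr_le0_ge0.
rewrite mulrC ler_pdivrMr //.
have : e * (size W %/ n)%:R <= e * Q by rewrite ler_pM2l.
apply: le_trans; apply: le_trans ek.
(* Here |theta2|^k = (theta1^k)^alpha, and theta1^k > n since m theta1^k > M n >= m n. *)
rewrite -alE -powR_mulrn ?powR_ge0 // -powRrM mulrC powRrM powR_mulrn ?(ltW th1_0) //.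
apply: ge0_ler_powR => //; rewrite ?nnegrE ?exprn_ge0 ?(ltW th1_0) // ltW //.
rewrite -(ltr_pM2l m0); apply: le_lt_trans kP.
by rewrite ler_pM2r.
Qed.

(** * The substitution matrix of a primitive substitution *)

Lemma ord2_other (j : 'I_2) : exists j', forall i, i != j -> i = j'.
Proof.
exists (if j == ord0 then ord_max else ord0).
by move: j => [[|[|//]] hj] [[|[|//]] hi] //= _; apply: val_inj.
Qed.

(** Otherwise zeta(j) would be a power of j, and i would never appear in any zeta^k(j). *)
Lemma primitive_offdiag (zeta : 'I_2 -> word) i j :
  is_substitution zeta -> is_primitive zeta -> i != j -> i \in zeta j.
Proof.
move=> zs zp ij; have [N NP] := primitive_mem zs zp.
apply: contraT => iNj; have := NP N i j (leqnn N); rewrite /subst_iter.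
suff -> : (i \in iter N (subst_word zeta) [:: j]) = false by [].
elim: N {NP} => [|N IHN] /=; first by rewrite inE (negbTE ij).
apply: contraFF IHN => /flattenP[_ /mapP[l lw ->]] il.
suff <- : l = i by [].
apply/eqP; apply: contraNT iNj => li; suff -> : j = l by [].
have [i' i'P] := ord2_other i.
by rewrite (i'P l li) [LHS]i'P // eq_sym.
Qed.

(* Otherwise the words [zeta^k(0)] would all be powers of a single letter. *)
Lemma primitive_diag (zeta : 'I_2 -> word) :
  is_substitution zeta -> is_primitive zeta -> exists i, i \in zeta i.
Proof.
move=> zs zp; have [N NP] := primitive_mem zs zp.
apply: contrapT => nd.
have [l lP] : exists l, forall x, x \in subst_iter zeta N ord0 -> x = l.
  elim: N {NP} => [|N [l lP]]; first by exists ord0 => x; rewrite inE => /eqP.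
  have [l' l'P] := ord2_other l; exists l' => x.
  case/flattenP => _ /mapP[y yw ->]; rewrite (lP y yw) => xl.
  by apply: l'P; apply/eqP => xE; apply: nd; exists l; rewrite -{1}xE.
have := lP _ (NP N ord0 ord0 (leqnn N)).
by rewrite -(lP _ (NP N ord_max ord0 (leqnn N))).
Qed.

(** This is the characteristic equation. Eliminating either coordinate of an eigenvector from its
    two equations shows that [delta] annihilates the other one. *)
Lemma eigenvalue_mx2 (F : fieldType) (A : 'M[F]_2) t :
  eigenvalue A t ->
  (t - A ord0 ord0) * (t - A ord_max ord_max) = A ord0 ord_max * A ord_max ord0.
Proof.
case/eigenvalueP => x xA xn0.
have col j : x 0 ord0 * A ord0 j + x 0 ord_max * A ord_max j = t * x 0 j.
  have := congr1 (fun B : 'rV_2 => B 0 j) xA.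
  rewrite !mxE big_ord_recl big_ord1 => <-.
  by congr (_ + x 0 _ * A _ _); apply: val_inj.
have e0 := col ord0; have e1 := col ord_max.
move: e0 e1; set a := A _ _; set b := A _ _; set c := A _ _; set d := A _ _.
move/esym/eqP; rewrite -subr_eq0 => /eqP e0.
move/esym/eqP; rewrite -subr_eq0 => /eqP e1.
apply/eqP; rewrite -subr_eq0; set delta := _ - _.
have d0 : delta * x 0 ord0 = 0.
  transitivity ((t - d) * 0 + b * 0 : F); last by rewrite !mulr0 addr0.
  by rewrite -{1}e0 -e1 /delta; ring.
have d1 : delta * x 0 ord_max = 0.
  transitivity ((t - a) * 0 + c * 0 : F); last by rewrite !mulr0 addr0.
  by rewrite -{1}e1 -e0 /delta; ring.
apply: contraNT xn0 => dn0; apply/eqP/rowP => i; rewrite mxE.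
apply: (mulfI dn0); rewrite mulr0.
case: i => [[|[|//]] hi].
  by rewrite (_ : Ordinal hi = ord0) //; apply: val_inj.
by rewrite (_ : Ordinal hi = ord_max) //; apply: val_inj.
Qed.

(** The vector solves the first column of u A = t u identically; the second column is the
    characteristic equation. *)
Lemma left_eigenvector_char (R : comNzRingType) (zeta : 'I_2 -> word) (t : R) :
  let A := subst_mx R zeta in
  (t - A ord0 ord0) * (t - A ord_max ord_max) = A ord0 ord_max * A ord_max ord0 ->
  left_eigenvector zeta t
    (fun i => if i == ord0 then A ord_max ord0 else t - A ord0 ord0).
Proof.
move=> A chi i; rewrite weight_count /= -[_ *+ _]mulr_natr -[X in _ + X]mulr_natr.
have -> : (count_mem ord0 (zeta i))%:R = A ord0 i by rewrite mxE.
have -> : (count_mem ord_max (zeta i))%:R = A ord_max i by rewrite mxE.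
case: i => [[|[|//]] hi] /=.
  by rewrite (_ : Ordinal hi = ord0); [ring | apply: val_inj].
rewrite (_ : Ordinal hi = ord_max); last exact: val_inj.
apply/eqP; rewrite mulrC -chi -subr_eq0; apply/eqP; ring.
Qed.

(** * Extremal numbers of zeros and the conclusion *)

Lemma zeros_le_max (zeta : 'I_2 -> word) w :
  allowed zeta w -> (zeros w <= max_zeros zeta (size w))%N.
Proof.
move=> wa; apply: (leq_bigmax_cond (in_tuple w)).
exact/asboolP.
Qed.

Lemma min_le_zeros (zeta : 'I_2 -> word) w :
  allowed zeta w -> (min_zeros zeta (size w) <= zeros w)%N.
Proof.
move=> wa; rewrite /min_zeros.
rewrite -leEnat -minEnat; apply: (bigmin_le_cond _ (j := in_tuple w)).
exact/asboolP.
Qed.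

Lemma size_count2 (w : word) : size w = (count_mem ord0 w + count_mem ord_max w)%N.
Proof.
by elim: w => [|[[|[|//]] hi] w IHw] //=; rewrite IHw /= ?add1n ?add0n ?addSn ?addnS.
Qed.

Theorem proposition1p5 (R : realType) (zeta : 'I_2 -> word)
    (zeta_subst : is_substitution zeta)
    (zeta_prim : is_primitive zeta)
    (zeta_aper : is_aperiodic zeta)
    (theta1 theta2 : R)
    (theta1_PF : PF_eigenvalue (subst_mx R zeta) theta1)
    (theta2_eig : eigenvalue (subst_mx R zeta) theta2)
    (theta2_other : theta2 != theta1)
    (theta2_gt1 : 1 < `|theta2|) :
  let alpha : R := ln `|theta2| / ln theta1 in
  0 < alpha < 1 /\
  exists2 c1 : R, 0 < c1 &
    forall n : nat, (1 <= n)%N ->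
      c1 * n%:R `^ alpha <= (max_zeros zeta n)%:R - (min_zeros zeta n)%:R.
Proof.
set alpha := ln _ / _; move=> /=.
have chi1 := eigenvalue_mx2 theta1_PF.1; have chi2 := eigenvalue_mx2 theta2_eig.
have ev1 := left_eigenvector_char chi1; have ev2 := left_eigenvector_char chi2.
have entry_gt0 i j : i \in zeta j -> 0 < subst_mx R zeta i j.
  by rewrite mxE ltr0n -has_count has_pred1.
have b0 : 0 < subst_mx R zeta ord0 ord_max by exact/entry_gt0/primitive_offdiag.
have c0 : 0 < subst_mx R zeta ord_max ord0 by exact/entry_gt0/primitive_offdiag.
have trace_gt0 : 0 < subst_mx R zeta ord0 ord0 + subst_mx R zeta ord_max ord_max.
  have ge0 i : 0 <= subst_mx R zeta i i by rewrite mxE.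
  have [[[|[|//]] hi] /entry_gt0] := primitive_diag zeta_subst zeta_prim.
    by rewrite (_ : Ordinal hi = ord0); [move/ltr_pwDl; apply | apply: val_inj].
  by rewrite (_ : Ordinal hi = ord_max); [move/ltr_wpDl; apply | apply: val_inj].
move: chi1 chi2 ev1 ev2 b0 c0 trace_gt0.
set a := subst_mx _ _ ord0 ord0; set b := subst_mx _ _ ord0 ord_max.
set c := subst_mx _ _ ord_max ord0; set d := subst_mx _ _ ord_max ord_max.
move=> chi1 chi2 ev1 ev2 b0 c0 trace_gt0.
have norm_le : `|theta2| <= theta1 := theta1_PF.2 _ theta2_eig.
have lt21 : theta2 < theta1.
  by rewrite lt_neqAle theta2_other (le_trans (ler_norm _)).
have bc0 : 0 < b * c by rewrite mulr_gt0.
(* The difference of the two characteristic equations is divisible by theta1 - theta2, which is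
   nonzero. *)
have traceE : theta1 + theta2 = a + d.
  apply/eqP; rewrite -subr_eq0; apply/eqP/(@mulfI _ (theta1 - theta2)).
    by rewrite subr_eq0 eq_sym.
  rewrite mulr0 -(subrr (b * c)) -{1}chi1 -chi2; ring.
(* The positive trace excludes theta2 = -theta1. *)
have norm_lt : `|theta2| < theta1 by rewrite ltr_norml lt21 andbT; lra.
have th1_gt1 : 1 < theta1 := lt_trans theta2_gt1 norm_lt.
(* Since (theta2 - a)(theta2 - d) = b c > 0, the factors have the same sign. Both positive would
   give a + d < 2 theta2 < theta1 + theta2, against the trace. The same argument gives a < theta1;
   thus v is positive and u changes sign. *)
have lt2a : theta2 < a.
  rewrite ltNge; apply/negP => lea2.
  have : 0 < theta2 - d.
    by rewrite ltNge; apply/negP => led; move: bc0;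
      rewrite -chi2 ltNge mulr_ge0_le0 // subr_ge0.
  lra.
have lta1 : a < theta1.
  rewrite ltNge; apply/negP => le1a.
  have : theta1 - d < 0.
    by rewrite ltNge; apply/negP => led; move: bc0;
      rewrite -chi1 ltNge mulr_le0_ge0 // subr_le0.
  lra.
have ln1 : 0 < ln theta1 by rewrite ln_gt0.
have ln2 : 0 < ln `|theta2| by rewrite ln_gt0.
have al0 : 0 < alpha by rewrite divr_gt0.
split.
  rewrite al0 ltr_pdivrMr // mul1r ltr_ln // posrE; first exact: lt_trans theta2_gt1.
  exact: lt_trans th1_gt1.
have alE : theta1 `^ alpha = `|theta2|.
  rewrite /powR gt_eqF ?(lt_trans ltr01) // /alpha divfK ?gt_eqF //.
  by rewrite lnK // posrE (lt_trans ltr01).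
pose v i := if i == ord0 :> 'I_2 then c else theta1 - a.
pose u i := if i == ord0 :> 'I_2 then c else theta2 - a.
have m0 : 0 < Num.min c (theta1 - a) by rewrite lt_min c0 subr_gt0.
have mv i : Num.min c (theta1 - a) <= v i.
  by rewrite /v; case: ifP; rewrite ge_min lexx ?orbT.
have vM i : v i <= Num.max c (theta1 - a).
  by rewrite /v; case: ifP; rewrite le_max lexx ?orbT.
have u0 : 0 < u ord0 by [].
have u1 : u ord_max < 0 by rewrite /u /= subr_lt0.
have [k1 k1_gt0 k1P] := weight_block_ge (i1 := ord0) (i2 := ord_max)
  zeta_subst th1_gt1 ev1 m0 mv vM
  theta2_gt1 ev2 u0 u1 (ltW al0) alE.
have ev2N : left_eigenvector zeta theta2 (fun i => - u i).
  by move=> i; rewrite weightN ev2 mulrN.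
have [k2 k2_gt0 k2P] : exists2 k2, 0 < k2 & forall n e, (0 < n)%N ->
    (forall w K i, infix w (subst_iter zeta K i) -> size w = n ->
       weight (fun i => - u i) w <= e) -> k2 * n%:R `^ alpha <= e.
  by apply: (weight_block_ge (i1 := ord_max) (i2 := ord0) zeta_subst th1_gt1 ev1
    m0 mv vM theta2_gt1 ev2N _ _ (ltW al0) alE); rewrite ?oppr_gt0 ?oppr_lt0.
have u01 : 0 < u ord0 - u ord_max by rewrite subr_gt0 (lt_trans u1).
have weightE w : weight u w =
    (u ord0 - u ord_max) * (zeros w)%:R + u ord_max * (size w)%:R.
  rewrite weight_count -[_ *+ _]mulr_natr -[X in _ + X]mulr_natr.
  rewrite size_count2 -/(zeros w) natrD; ring.
(* Adding the bounds for u and -u cancels the term in n and leaves (u(0) - u(1)) times the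
   difference of maximum and minimum. *)
exists ((k1 + k2) / (u ord0 - u ord_max)) => [|n n0].
  exact: divr_gt0 (addr_gt0 k1_gt0 k2_gt0) u01.
have le1 : k1 * n%:R `^ alpha <=
    (u ord0 - u ord_max) * (max_zeros zeta n)%:R + u ord_max * n%:R.
  apply: k1P => // w K i wi sw; rewrite weightE sw lerD2r ler_pM2l // ler_nat -sw.
  exact/zeros_le_max/infix_allowed/wi.
have le2 : k2 * n%:R `^ alpha <=
    - ((u ord0 - u ord_max) * (min_zeros zeta n)%:R + u ord_max * n%:R).
  apply: k2P => // w K i wi sw; rewrite weightN weightE sw lerN2 lerD2r ler_pM2l //.
  rewrite ler_nat -sw; exact/min_le_zeros/infix_allowed/wi.
rewrite mulrAC ler_pdivrMr // mulrDl; apply: le_trans (lerD le1 le2) _.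
by rewrite le_eqVlt; apply/orP; left; apply/eqP; ring.
Qed.
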